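(* There is a covariant functor $K_0^{\lambda}$ from the category $\underline{Cat}^{\otimes}_{\wedge}$ of abelian categories with tensor and exterior products (ACTEP's) to the category of finite dimensional augmented $\lambda$-rings, defined on objects by $$K_0^{\lambda}(\mathcal{C})=\{K_0(\mathcal{C}),\{\lambda^n\}_{n\ge 0}\},$$ where $K_0(\mathcal{C})$ is the Grothendieck ring of $\mathcal{C}$ and $\lambda^n$ is the operation on $K_0(\mathcal{C})$ induced by the $n$-th exterior product, and on morphisms by $f\mapsto f^*$.
   Context: An abelian category with tensor and exterior products (ACTEP) is a small abelian category $\mathcal{C}$ with the following structure. (1) A tensor product $\otimes:\mathcal{C}\times\mathcal{C}\to\mathcal{C}$ such that $\{\mathcal{C},\oplus,\otimes\}$ is an abelian tensor category: there are canonical isomorphisms $x\otimes y\cong y\otimes x$ and $(x\oplus y)\otimes z\cong (x\otimes z)\oplus (y\otimes z)$, a unique unit object $\mathbf{1}^{\otimes}$ with canonical isomorphisms $\mathbf{1}^{\otimes}\otimes x\cong x\otimes \mathbf{1}^{\otimes}\cong x$, and for each object $x$ the endofunctor $x\otimes -$ is exact. (2) A function $rk:Ob(\mathcal{C})\to\mathbb{N}$ with $rk(\mathbf{1}^{\otimes})=1$, additive on exact sequences. (3) For every $k\ge 0$ an endofunctor $\lambda^k:\mathcal{C}\to\mathcal{C}$ (exterior product) with $\lambda^i(x)=0$ for $i>rk(x)$, $\lambda^0(x)=\mathbf{1}^{\otimes}$, $\lambda^1(x)=x$, and such that for any exact sequence $0\to x'\to x\to x''\to 0$ in $\mathcal{C}$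 and any $p\ge 2$ there is a filtration $0=F_{p+1}\subseteq F_p\subseteq\cdots\subseteq F_1\subseteq F_0=\lambda^p(x)$ with canonical isomorphisms $F_i/F_{i+1}\cong\lambda^i(x')\otimes\lambda^{p-i}(x'')$. A morphism of ACTEP's $f:\mathcal{D}\to\mathcal{C}$ is an additive tensor functor commuting with exterior products, i.e. with canonical isomorphisms $f(\lambda^l(x))\cong\lambda^l(f(x))$ for all $l\ge 0$. The category $\underline{Cat}^{\otimes}_{\wedge}$ has ACTEP's as objects and morphisms of ACTEP's as morphisms. $K_0(\mathcal{C})$ is the Grothendieck group of $\mathcal{C}$ (with respect to short exact sequences), with addition induced by $\oplus$, multiplication induced by $\otimes$, and unit $[\mathbf{1}^{\otimes}]$. A morphism $f:\mathcal{D}\to\mathcal{C}$ induces $f^*:K_0(\mathcal{D})\to K_0(\mathcal{C})$, $[x]\mapsto[f(x)]$. Operations $\lambda^n$: for an object $x$ put $\lambda_t(x)=\sum_{l\ge 0}[\lambda^l(x)]t^l\in 1+K_0(\mathcal{C})[[t]]$, the multiplicative group of power series with constant term $1$. This extends to a group homomorphism $\lambda_t:K_0(\mathcal{C})\to 1+K_0(\mathcal{C})[[t]]$ with $\lambda_t(n[x]-m[y])=\lambda_t(x)^n\lambda_t(y)^{-m}$, and $\lambda^l(\omega)$ is defined by $\lambda_t(\omega)=\sum_{l\ge 0}\lambda^l(\omega)t^l$. A $\lambda$-ring is a commutative ring $R$ with unit and maps $\lambda^n:R\to R$ ($n\ge 0$) with $\lambda^0(x)=1$, $\lambda^1(x)=x$,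 $\lambda^n(x+y)=\sum_{i+j=n}\lambda^i(x)\lambda^j(y)$. Morphisms are ring homomorphisms commuting with all $\lambda^n$. It is finite dimensional if every element is a difference of two elements $x$ for which $\lambda^n(x)=0$ for all large $n$, and augmented if it is equipped with a morphism of $\lambda$-rings to $\mathbb{Z}$, where $\lambda^n(m)=\binom{m}{n}$ on $\mathbb{Z}$. The augmentation on $K_0(\mathcal{C})$ is the map $K_0(\mathcal{C})\to\mathbb{Z}$ induced by $rk$.
   Formalization: The rank is also required to satisfy rk(λ^n(x)) = binom(rk(x), n), without which it need not induce an augmentation, and morphisms of ACTEP's are required to be exact, without which [x] ↦ [f(x)] need not be well defined on K_0. *)

(* Defs.v *)
From HB Require Import structures.
From mathcomp Require Import all_boot all_order all_algebra.
From mathcomp Require Import boolp.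

Set Implicit Arguments.
Unset Strict Implicit.
Unset Printing Implicit Defensive.

Import GRing.Theory.
Local Open Scope ring_scope.
Local Open Scope quotient_scope.

(* A small preadditive category.  "Small" means that the objects form a type in
   a fixed universe; asking the Hom-groups to be zmodTypes is no restriction,
   since every type carries a classical choiceType structure. *)
Record preadditive := Preadditive {
  ob :> Type;
  hom : ob -> ob -> zmodType;
  idm : forall x, hom x x;
  cmp : forall x y z, hom y z -> hom x y -> hom x z;
  cmpA : forall x y z t (h : hom z t) (g : hom y z) (f : hom x y),
    cmp h (cmp g f) = cmp (cmp h g) f;
  cmp1m : forall x y (f : hom x y), cmp (idm y) f = f;
  cmpm1 : forall x y (f : hom x y), cmp f (idm x) = f;
  cmpDl : forall x y z (g g' : hom y z) (f : hom x y),
    cmp (g + g') f = cmp g f + cmp g' f;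
  cmpDr : forall x y z (g : hom y z) (f f' : hom x y),
    cmp g (f + f') = cmp g f + cmp g f' }.

Arguments hom {_} _ _.
Arguments idm {_} _.
Arguments cmp {_ _ _ _} _ _.

Declare Scope actep_scope.
Delimit Scope actep_scope with actep.
Local Open Scope actep_scope.

Notation "g ∘ f" := (cmp g f) (at level 40, left associativity) : actep_scope.

Section CategoryNotions.
Variable A : preadditive.

Definition is_iso (x y : A) (f : hom x y) : Prop :=
  exists g : hom y x, g ∘ f = idm x /\ f ∘ g = idm y.

Definition isomorphic (x y : A) : Prop := exists f : hom x y, is_iso f.

Definition mono (x y : A) (f : hom x y) : Prop :=
  forall w (g h : hom w x), f ∘ g = f ∘ h -> g = h.

Definition epi (x y : A) (f : hom x y) : Prop :=
  forall z (g h : hom y z), g ∘ f = h ∘ f -> g = h.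

(* zero object: both initial and terminal *)
Definition is_zero (z : A) : Prop :=
  (forall x (f g : hom z x), f = g) /\ (forall x (f g : hom x z), f = g).

Definition is_biproduct (x y b : A)
    (i1 : hom x b) (i2 : hom y b) (p1 : hom b x) (p2 : hom b y) : Prop :=
  [/\ p1 ∘ i1 = idm x, p2 ∘ i2 = idm y, p1 ∘ i2 = 0, p2 ∘ i1 = 0
    & i1 ∘ p1 + i2 ∘ p2 = idm b].

Definition is_kernel (k x y : A) (i : hom k x) (f : hom x y) : Prop :=
  f ∘ i = 0 /\
  forall w (g : hom w x), f ∘ g = 0 -> exists! u : hom w k, i ∘ u = g.

Definition is_cokernel (x y c : A) (p : hom y c) (f : hom x y) : Prop :=
  p ∘ f = 0 /\
  forall w (g : hom y w), g ∘ f = 0 -> exists! u : hom c w, u ∘ p = g.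

(* 0 -> x' -> x -> x'' -> 0 is exact *)
Definition short_exact (x' x x'' : A) (i : hom x' x) (p : hom x x'') : Prop :=
  is_kernel i p /\ is_cokernel p i.

End CategoryNotions.

Record abelian := Abelian {
  ab_pre :> preadditive;
  ab_zero : exists z : ab_pre, is_zero z;
  ab_biproduct : forall x y : ab_pre, exists (b : ab_pre)
    (i1 : hom x b) (i2 : hom y b) (p1 : hom b x) (p2 : hom b y),
    is_biproduct i1 i2 p1 p2;
  ab_kernel : forall (x y : ab_pre) (f : hom x y),
    exists k (i : hom k x), is_kernel i f;
  ab_cokernel : forall (x y : ab_pre) (f : hom x y),
    exists c (p : hom y c), is_cokernel p f;
  ab_mono : forall (x y : ab_pre) (f : hom x y), mono f ->
    exists z (g : hom y z), is_kernel f g;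
  ab_epi : forall (x y : ab_pre) (f : hom x y), epi f ->
    exists z (g : hom z x), is_cokernel f g }.

(* An abelian tensor category: a symmetric monoidal structure (with Mac Lane's
   coherence conditions) on an abelian category, distributive over the direct
   sum and exact. *)
Record abelian_tensor := AbelianTensor {
  at_ab :> abelian;
  tens : at_ab -> at_ab -> at_ab;
  tensm : forall x x' y y' : at_ab,
    hom x x' -> hom y y' -> hom (tens x y) (tens x' y');
  tensm1 : forall x y, tensm (idm x) (idm y) = idm (tens x y);
  tensm_cmp : forall x x' x'' y y' y''
    (f' : hom x' x'') (f : hom x x') (g' : hom y' y'') (g : hom y y'),
    tensm (f' ∘ f) (g' ∘ g) = tensm f' g' ∘ tensm f g;
  unit : at_ab;
  assoc : forall x y z, hom (tens x (tens y z)) (tens (tens x y) z);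
  assoc_iso : forall x y z, is_iso (assoc x y z);
  assoc_nat : forall x x' y y' z z' (f : hom x x') (g : hom y y') (h : hom z z'),
    assoc x' y' z' ∘ tensm f (tensm g h) = tensm (tensm f g) h ∘ assoc x y z;
  comm : forall x y, hom (tens x y) (tens y x);
  comm_nat : forall x x' y y' (f : hom x x') (g : hom y y'),
    comm x' y' ∘ tensm f g = tensm g f ∘ comm x y;
  comm_sym : forall x y, comm y x ∘ comm x y = idm (tens x y);
  lunit : forall x, hom (tens unit x) x;
  lunit_iso : forall x, is_iso (lunit x);
  lunit_nat : forall x y (f : hom x y),
    lunit y ∘ tensm (idm unit) f = f ∘ lunit x;
  runit : forall x, hom (tens x unit) x;
  runit_iso : forall x, is_iso (runit x);
  runit_nat : forall x y (f : hom x y),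
    runit y ∘ tensm f (idm unit) = f ∘ runit x;
  pentagon : forall x y z t,
    assoc (tens x y) z t ∘ assoc x y (tens z t) =
    tensm (assoc x y z) (idm t) ∘ assoc x (tens y z) t ∘
      tensm (idm x) (assoc y z t);
  triangle : forall x y,
    tensm (runit x) (idm y) ∘ assoc x unit y = tensm (idm x) (lunit y);
  hexagon : forall x y z,
    assoc z x y ∘ comm (tens x y) z ∘ assoc x y z =
    tensm (comm x z) (idm y) ∘ assoc x z y ∘ tensm (idm x) (comm y z);
  (* (x ⊕ y) ⊗ z is, through the canonical maps, (x ⊗ z) ⊕ (y ⊗ z) *)
  tens_biproduct : forall (x y b z : at_ab)
    (i1 : hom x b) (i2 : hom y b) (p1 : hom b x) (p2 : hom b y),
    is_biproduct i1 i2 p1 p2 ->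
    is_biproduct (tensm i1 (idm z)) (tensm i2 (idm z))
                 (tensm p1 (idm z)) (tensm p2 (idm z));
  tens_exact : forall (z x' x x'' : at_ab) (i : hom x' x) (p : hom x x''),
    short_exact i p -> short_exact (tensm (idm z) i) (tensm (idm z) p) }.

Arguments tens {_} _ _.
Arguments tensm {_ _ _ _ _} _ _.
Arguments unit {_}.
Arguments assoc {_} _ _ _.
Arguments comm {_} _ _.
Arguments lunit {_} _.
Arguments runit {_} _.

Notation "x ⊗ y" := (tens x y) (at level 40, left associativity) : actep_scope.
Notation "f ⊠ g" := (tensm f g) (at level 40, left associativity) : actep_scope.

(* [rk_ext] says that rk is compatible with the operations lambda^n of Z, as it
   must be to induce an augmentation; applied to ext 2 (x ⊕ y) it also forces
   rk (x ⊗ y) = rk x * rk y.  It does not follow from the other axioms: on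
   Z-graded vector spaces with the usual exterior powers, the homogeneous lines
   of degree n <> 0 may be given any positive rank.

   The filtration in [ext_filtration] is a chain of inclusions
   F (n+1) -> F n -> ... -> F 0 = ext n x; the values of F beyond n + 1 are
   irrelevant. *)
Record actep := Actep {
  ac_at :> abelian_tensor;
  rk : ac_at -> nat;
  rk_unit : rk unit = 1%N;
  rk_exact : forall (x' x x'' : ac_at) (i : hom x' x) (p : hom x x''),
    short_exact i p -> rk x = (rk x' + rk x'')%N;
  ext : nat -> ac_at -> ac_at;
  extm : forall n (x y : ac_at), hom x y -> hom (ext n x) (ext n y);
  extm1 : forall n x, extm n (idm x) = idm (ext n x);
  extm_cmp : forall n x y z (g : hom y z) (f : hom x y),
    extm n (g ∘ f) = extm n g ∘ extm n f;
  ext_gt_rk : forall n x, (rk x < n)%N -> is_zero (ext n x);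
  ext0 : forall x, isomorphic (ext 0 x) unit;
  ext1 : forall x, isomorphic (ext 1 x) x;
  ext_filtration : forall (x' x x'' : ac_at) (i : hom x' x) (p : hom x x''),
    short_exact i p -> forall n, (2 <= n)%N ->
    exists (F : nat -> ac_at) (inc : forall k, hom (F k.+1) (F k)),
      [/\ F 0%N = ext n x, is_zero (F n.+1)
        & forall k, (k <= n)%N ->
          exists q : hom (F k) (ext k x' ⊗ ext (n - k) x''),
            short_exact (inc k) q];
  rk_ext : forall n x, rk (ext n x) = 'C(rk x, n) }.

Arguments rk {_} _.
Arguments ext {_} _ _.
Arguments extm {_} _ {_ _} _.

(* Morphisms of ACTEPs: exact additive symmetric monoidal functors with natural
   isomorphisms f (ext l x) ~ ext l (f x).  Exactness is what makes
   [x] |-> [f x] well defined on Grothendieck groups.  The rank is not required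
   to be preserved. *)
Record actep_mor (D C : actep) := ActepMor {
  fo :> D -> C;
  fm : forall x y : D, hom x y -> hom (fo x) (fo y);
  fm1 : forall x, fm (idm x) = idm (fo x);
  fm_cmp : forall x y z (g : hom y z) (f : hom x y),
    fm (g ∘ f) = fm g ∘ fm f;
  fm_add : forall x y (g h : hom x y), fm (g + h) = fm g + fm h;
  fm_exact : forall (x' x x'' : D) (i : hom x' x) (p : hom x x''),
    short_exact i p -> short_exact (fm i) (fm p);
  ft : forall x y, hom (fo x ⊗ fo y) (fo (x ⊗ y));
  ft_iso : forall x y, is_iso (ft x y);
  ft_nat : forall x x' y y' (g : hom x x') (h : hom y y'),
    ft x' y' ∘ (fm g ⊠ fm h) = fm (g ⊠ h) ∘ ft x y;
  fu : hom unit (fo unit);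
  fu_iso : is_iso fu;
  ft_assoc : forall x y z,
    fm (assoc x y z) ∘ ft x (y ⊗ z) ∘ (idm (fo x) ⊠ ft y z) =
    ft (x ⊗ y) z ∘ (ft x y ⊠ idm (fo z)) ∘ assoc (fo x) (fo y) (fo z);
  ft_comm : forall x y, fm (comm x y) ∘ ft x y = ft y x ∘ comm (fo x) (fo y);
  ft_lunit : forall x,
    fm (lunit x) ∘ ft unit x ∘ (fu ⊠ idm (fo x)) = lunit (fo x);
  ft_runit : forall x,
    fm (runit x) ∘ ft x unit ∘ (idm (fo x) ⊠ fu) = runit (fo x);
  fe : forall n x, hom (fo (ext n x)) (ext n (fo x));
  fe_iso : forall n x, is_iso (fe n x);
  fe_nat : forall n x y (g : hom x y),
    fe n y ∘ fm (extm n g) = extm n (fm g) ∘ fe n x }.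

Arguments fm {_ _} _ {_ _} _.
Arguments ft {_ _} _ _ _.
Arguments fu {_ _} _.
Arguments fe {_ _} _ _ _.

Record category := Category {
  cob :> Type;
  chom : cob -> cob -> Type;
  cid : forall x, chom x x;
  ccmp : forall x y z, chom y z -> chom x y -> chom x z;
  ccmpA : forall x y z t (h : chom z t) (g : chom y z) (f : chom x y),
    ccmp h (ccmp g f) = ccmp (ccmp h g) f;
  ccmp1f : forall x y (f : chom x y), ccmp (cid y) f = f;
  ccmpf1 : forall x y (f : chom x y), ccmp f (cid x) = f }.

Arguments chom {_} _ _.
Arguments cid {_} _.
Arguments ccmp {_ _ _ _} _ _.

(* The covariant functors with object map [o]. *)
Record functor_on (X Y : category) (o : X -> Y) := FunctorOn {
  fmap : forall x y : X, chom x y -> chom (o x) (o y);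
  fmap_id : forall x, fmap (cid x) = cid (o x);
  fmap_cmp : forall x y z (g : chom y z) (f : chom x y),
    fmap (ccmp g f) = ccmp (fmap g) (fmap f) }.

Arguments fmap {_ _ _} _ {_ _} _.

Section IsoFacts.
Variable A : preadditive.

Lemma iso_idm (x : A) : is_iso (idm x).
Proof. by exists (idm x); rewrite cmp1m. Qed.

Lemma iso_cmp (x y z : A) (g : hom y z) (f : hom x y) :
  is_iso g -> is_iso f -> is_iso (g ∘ f).
Proof.
move=> [g' [g'g gg']] [f' [f'f ff']]; exists (f' ∘ g'); split.
  by rewrite -cmpA (cmpA g') g'g cmp1m.
by rewrite -cmpA (cmpA f) ff' cmp1m.
Qed.

Lemma isoC (x y : A) : isomorphic x y -> isomorphic y x.
Proof. by move=> [f [g [gf fg]]]; exists g, f. Qed.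

Lemma short_exact_iso (x y z : A) (f : hom x y) (p : hom y z) :
  is_zero z -> is_iso f -> short_exact f p.
Proof.
move=> [zi zt] [g [gf fg]]; split; split; try exact: zt.
- move=> w h _; exists (g ∘ h); split; first by rewrite cmpA fg cmp1m.
  by move=> u <-; rewrite cmpA gf cmp1m.
- move=> w h hf; have h0 : h = 0.
    have c0 : (0 : hom x w) ∘ g = 0.
      by apply: (addrI (0 ∘ g)); rewrite -cmpDl !addr0.
    by rewrite -(cmpm1 h) -fg cmpA hf c0.
  exists 0; split; last by move=> u _; apply: zi.
  by rewrite h0; apply: (addrI (0 ∘ p)); rewrite -cmpDl !addr0.
Qed.

End IsoFacts.

Section MorphismFacts.
Variables (D C : actep) (f : actep_mor D C).

Lemma fm_iso (x y : D) (g : hom x y) : is_iso g -> is_iso (fm f g).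
Proof.
by move=> [h [hg gh]]; exists (fm f h); rewrite -!fm_cmp hg gh !fm1.
Qed.

Lemma tens_idl (x y y' y'' : C) (g' : hom y' y'') (g : hom y y') :
  idm x ⊠ (g' ∘ g) = (idm x ⊠ g') ∘ (idm x ⊠ g).
Proof. by rewrite -tensm_cmp cmp1m. Qed.

Lemma tens_idr (x y y' y'' : C) (g' : hom y' y'') (g : hom y y') :
  (g' ∘ g) ⊠ idm x = (g' ⊠ idm x) ∘ (g ⊠ idm x).
Proof. by rewrite -tensm_cmp cmp1m. Qed.

End MorphismFacts.

Lemma actep_mor_eq (D C : actep) (o : D -> C)
    (m : forall x y : D, hom x y -> hom (o x) (o y))
    t t' u u' e e' a1 a2 a3 a4 a5 a6 a7 a8 a9 a10 a11 a12 a13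
    b1 b2 b3 b4 b5 b6 b7 b8 b9 b10 b11 b12 b13 :
  (forall x y, t x y = t' x y) -> u = u' -> (forall n x, e n x = e' n x) ->
  @ActepMor D C o m a1 a2 a3 a4 t a5 a6 u a7 a8 a9 a10 a11 e a12 a13 =
  @ActepMor D C o m b1 b2 b3 b4 t' b5 b6 u' b7 b8 b9 b10 b11 e' b12 b13.
Proof.
move=> tt' uu' ee'.
have {}tt' : t = t' by apply: functional_extensionality_dep => x;
  apply: functional_extensionality_dep => y; apply: tt'.
have {}ee' : e = e' by apply: functional_extensionality_dep => n;
  apply: functional_extensionality_dep => x; apply: ee'.
subst t' u' e'; rewrite (Prop_irrelevance a1 b1)
  (Prop_irrelevance a2 b2)
  (Prop_irrelevance a3 b3)
  (Prop_irrelevance a4 b4)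
  (Prop_irrelevance a5 b5)
  (Prop_irrelevance a6 b6)
  (Prop_irrelevance a7 b7)
  (Prop_irrelevance a8 b8)
  (Prop_irrelevance a9 b9)
  (Prop_irrelevance a10 b10)
  (Prop_irrelevance a11 b11)
  (Prop_irrelevance a12 b12)
  (Prop_irrelevance a13 b13) //.
Qed.

Definition actep_id (C : actep) : actep_mor C C.
Proof.
refine (@ActepMor C C (fun x => x) (fun x y g => g) _ _ _ _
  (fun x y => idm (x ⊗ y)) _ _ (idm unit) _ _ _ _ _
  (fun n x => idm (ext n x)) _ _) => //.
- by move=> x y; apply: iso_idm.
- by move=> *; rewrite cmp1m cmpm1.
- exact: iso_idm.
- by move=> *; rewrite !tensm1 !cmpm1 cmp1m.
- by move=> *; rewrite cmpm1 cmp1m.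
- by move=> *; rewrite !tensm1 !cmpm1.
- by move=> *; rewrite !tensm1 !cmpm1.
- by move=> n x; apply: iso_idm.
- by move=> *; rewrite cmp1m cmpm1.
Defined.

Definition actep_cmp (E D C : actep) (g : actep_mor D C) (f : actep_mor E D) :
  actep_mor E C.
Proof.
refine (@ActepMor E C (fun x => g (f x)) (fun x y h => fm g (fm f h)) _ _ _ _
  (fun x y => fm g (ft f x y) ∘ ft g (f x) (f y)) _ _
  (fm g (fu f) ∘ fu g) _ _ _ _ _
  (fun n x => fe g n (f x) ∘ fm g (fe f n x)) _ _).
- by move=> x; rewrite !fm1.
- by move=> *; rewrite !fm_cmp.
- by move=> *; rewrite !fm_add.
- by move=> x' x x'' i p se; do 2! apply: fm_exact.
- by move=> x y; apply: iso_cmp (ft_iso _ _ _); apply/fm_iso/ft_iso.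
- by move=> x x' y y' h k; rewrite -cmpA ft_nat cmpA -fm_cmp ft_nat fm_cmp cmpA.
- by apply: iso_cmp (fu_iso _); apply/fm_iso/fu_iso.
- move=> x y z; have := congr1 (fm g) (ft_assoc f x y z); rewrite !fm_cmp => fA.
  have gA := ft_assoc g (f x) (f y) (f z).
  have n1 := ft_nat g (idm (f x)) (ft f y z).
  have n2 := ft_nat g (ft f x y) (idm (f z)).
  rewrite !fm1 in n1 n2.
  rewrite tens_idl tens_idr -!cmpA (cmpA (ft g (f x) _)) n1 -!cmpA.
  rewrite (cmpA (ft g _ (f z))) n2 -!cmpA.
  rewrite (cmpA (ft g (f x ⊗ f y) (f z))) -gA.
  by rewrite -!cmpA in fA *; rewrite !cmpA in fA *; rewrite fA.
- move=> x y; have := congr1 (fm g) (ft_comm f x y); rewrite !fm_cmp => fC.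
  by rewrite cmpA fC -cmpA ft_comm cmpA.
- move=> x; have := congr1 (fm g) (ft_lunit f x); rewrite !fm_cmp => fL.
  have n1 := ft_nat g (fu f) (idm (f x)); rewrite fm1 in n1.
  rewrite tens_idr -!cmpA (cmpA (ft g _ _)) n1 -(ft_lunit g (f x)) -fL.
  by rewrite !cmpA.
- move=> x; have := congr1 (fm g) (ft_runit f x); rewrite !fm_cmp => fR.
  have n1 := ft_nat g (idm (f x)) (fu f); rewrite fm1 in n1.
  rewrite tens_idl -!cmpA (cmpA (ft g _ _)) n1 -(ft_runit g (f x)) -fR.
  by rewrite !cmpA.
- by move=> n x; apply: iso_cmp; [apply: fe_iso | apply/fm_iso/fe_iso].
- by move=> n x y h; rewrite -cmpA -fm_cmp fe_nat fm_cmp cmpA fe_nat cmpA.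
Defined.

Definition ACTEP : category.
Proof.
refine (@Category actep actep_mor actep_id actep_cmp _ _ _).
- move=> x y z t h g f; apply: actep_mor_eq => *.
  + by rewrite fm_cmp cmpA.
  + by rewrite fm_cmp cmpA.
  + by rewrite fm_cmp cmpA.
- by move=> x y [*]; apply: actep_mor_eq => * /=; rewrite ?cmpm1 ?cmp1m.
- move=> x y f; case: f => *; apply: actep_mor_eq => * /=.
  all: by rewrite ?cmpm1 ?cmp1m; auto; match goal with
    H : forall x, ?m x x (idm x) = _ |- _ => rewrite H ?cmpm1 ?cmp1m end.
Defined.

(* The Grothendieck group: the abelian group presented by the generators [x],
   for x an object, and the relations [x] = [x'] + [x''], for
   0 -> x' -> x -> x'' -> 0 exact.  It is built as the quotient of the
   group words by the congruence generated by the axioms of abelian groups and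
   these relations. *)
Inductive word (T : Type) : Type :=
  | Gen of T
  | Zero
  | Opp of word T
  | Add of word T & word T.

Arguments Zero {T}.

HB.instance Definition _ T := gen_eqMixin (word T).
HB.instance Definition _ T := gen_choiceMixin (word T).

Section GrothendieckGroup.
Variable A : abelian.

Inductive weq : word A -> word A -> Prop :=
  | weq_refl a : weq a a
  | weq_sym a b : weq a b -> weq b a
  | weq_trans a b c : weq a b -> weq b c -> weq a c
  | weq_opp a b : weq a b -> weq (Opp a) (Opp b)
  | weq_add a a' b b' : weq a a' -> weq b b' -> weq (Add a b) (Add a' b')
  | weq_addA a b c : weq (Add a (Add b c)) (Add (Add a b) c)
  | weq_addC a b : weq (Add a b) (Add b a)
  | weq_add0 a : weq (Add Zero a) a
  | weq_addN a : weq (Add (Opp a) a) Zero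
  | weq_exact (x' x x'' : A) (i : hom x' x) (p : hom x x'') :
      short_exact i p -> weq (Gen x) (Add (Gen x') (Gen x'')).

Definition weqb (a b : word A) : bool := `[< weq a b >].

Lemma weqb_refl : reflexive weqb.
Proof. by move=> a; apply/asboolP/weq_refl. Qed.

Lemma weqb_sym : symmetric weqb.
Proof. by move=> a b; apply/asboolP/asboolP => /weq_sym. Qed.

Lemma weqb_trans : transitive weqb.
Proof.
by move=> b a c /asboolP ab /asboolP bc; apply/asboolP/(weq_trans ab bc).
Qed.

Canonical weqb_equiv := EquivRel weqb weqb_refl weqb_sym weqb_trans.

Definition K0 := {eq_quot weqb_equiv}.

HB.instance Definition _ := Choice.on K0.
HB.instance Definition _ := EqQuotient.on K0.

Definition wcl (a : word A) : K0 := \pi_K0 a.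

Lemma wclP a b : wcl a = wcl b <-> weq a b.
Proof. by split => [/eqmodP/asboolP | ab] //; apply/eqmodP/asboolP. Qed.

Lemma wcl_repr (u : K0) : wcl (repr u) = u.
Proof. exact: reprK. Qed.

Lemma weq_repr a : weq (repr (wcl a)) a.
Proof. by apply/wclP; rewrite wcl_repr. Qed.

Definition K0_opp (u : K0) : K0 := wcl (Opp (repr u)).
Definition K0_add (u v : K0) : K0 := wcl (Add (repr u) (repr v)).

Lemma K0_addE a b : K0_add (wcl a) (wcl b) = wcl (Add a b).
Proof. by apply/wclP/weq_add; apply: weq_repr. Qed.

Lemma K0_oppE a : K0_opp (wcl a) = wcl (Opp a).
Proof. by apply/wclP/weq_opp/weq_repr. Qed.

Lemma K0_addA : associative K0_add.
Proof.
move=> u v w; rewrite -(wcl_repr u) -(wcl_repr v) -(wcl_repr w) !K0_addE.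
exact/wclP/weq_addA.
Qed.

Lemma K0_addC : commutative K0_add.
Proof. by move=> u v; apply/wclP/weq_addC. Qed.

Lemma K0_add0 : left_id (wcl Zero) K0_add.
Proof.
by move=> u; rewrite -(wcl_repr u) K0_addE; apply/wclP/weq_add0.
Qed.

Lemma K0_addN : left_inverse (wcl Zero) K0_opp K0_add.
Proof.
by move=> u; rewrite -(wcl_repr u) K0_oppE K0_addE; apply/wclP/weq_addN.
Qed.

HB.instance Definition _ :=
  GRing.isZmodule.Build K0 K0_addA K0_addC K0_add0 K0_addN.

Definition cl (x : A) : K0 := wcl (Gen x).

Lemma wclD a b : wcl (Add a b) = wcl a + wcl b.
Proof. by rewrite -K0_addE. Qed.

Lemma wclN a : wcl (Opp a) = - wcl a.
Proof. by rewrite -K0_oppE. Qed.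

Lemma wcl0 : wcl Zero = 0.
Proof. by []. Qed.

Lemma cl_exact (x' x x'' : A) (i : hom x' x) (p : hom x x'') :
  short_exact i p -> cl x = cl x' + cl x''.
Proof. by move=> se; rewrite -wclD; apply/wclP/weq_exact/se. Qed.

Lemma cl_zero (z : A) : is_zero z -> cl z = 0.
Proof.
move=> z0; have := cl_exact (short_exact_iso (0 : hom z z) z0 (iso_idm z)).
by move=> e; apply: (addrI (cl z)); rewrite -e addr0.
Qed.

Lemma cl_iso (x y : A) : isomorphic x y -> cl x = cl y.
Proof.
move=> [f fi]; have [z z0] := ab_zero A.
by rewrite (cl_exact (short_exact_iso (0 : hom y z) z0 fi)) (cl_zero z0) addr0.
Qed.

End GrothendieckGroup.

Arguments wcl {A} _.
Arguments cl {A} _.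

(* The product of K0, the biadditive map with [x] [y] = [x ⊗ y]. *)
Section GrothendieckRing.
Variable A : abelian_tensor.

Fixpoint wmulg (x : A) (b : word A) : word A :=
  match b with
  | Gen y => Gen (x ⊗ y)
  | Zero => Zero
  | Opp b => Opp (wmulg x b)
  | Add b c => Add (wmulg x b) (wmulg x c)
  end.

Fixpoint wmul (a b : word A) : word A :=
  match a with
  | Gen x => wmulg x b
  | Zero => Zero
  | Opp a => Opp (wmul a b)
  | Add a c => Add (wmul a b) (wmul c b)
  end.

Lemma wmulg_weq x b c : weq b c -> wcl (wmulg x b) = wcl (wmulg x c).
Proof.
elim=> {b c} //=.
- by move=> a b c _ -> _ ->.
- by move=> a b _ e; rewrite !wclN e.
- by move=> a a' b b' _ e _ e'; rewrite !wclD e e'.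
- by move=> a b c; rewrite !wclD addrA.
- by move=> a b; rewrite !wclD addrC.
- by move=> a; rewrite wclD add0r.
- by move=> a; rewrite wclD wclN addNr.
- by move=> x' y x'' i p se; rewrite wclD; apply: cl_exact (tens_exact x se).
Qed.

Lemma wmul_weqr a b c : weq b c -> wcl (wmul a b) = wcl (wmul a c).
Proof.
move=> bc; elim: a => //=.
- by move=> x; apply: wmulg_weq.
- by move=> a e; rewrite !wclN e.
- by move=> a e a' e'; rewrite !wclD e e'.
Qed.

Lemma wmulDr a b c : wcl (wmul a (Add b c)) = wcl (wmul a b) + wcl (wmul a c).
Proof.
elim: a => /= [x||a e|a e a' e']; rewrite ?wclD ?wclN ?wcl0 ?addr0 //.
  by rewrite e opprD.
by rewrite e e' addrACA.
Qed.

Lemma wmulNr a b : wcl (wmul a (Opp b)) = - wcl (wmul a b).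
Proof.
elim: a => /= [x||a e|a e a' e']; rewrite ?wclD ?wclN ?wcl0 ?oppr0 ?e //.
by rewrite e' opprD.
Qed.

Lemma wmul0r a : wcl (wmul a Zero) = 0.
Proof.
elim: a => //= [a e|a e a' e']; rewrite ?wclD ?wclN ?e ?oppr0 //.
by rewrite e' addr0.
Qed.

Lemma wmulC a b : wcl (wmul a b) = wcl (wmul b a).
Proof.
elim: a => /= [x||a e|a e a' e'].
- elim: b => //= [y|b e|b e b' e'].
  + apply: cl_iso; exists (comm x y), (comm y x).
    by rewrite !comm_sym.
  + by rewrite !wclN e.
  + by rewrite !wclD e e'.
- by rewrite wmul0r.
- by rewrite wclN wmulNr e.
- by rewrite wclD wmulDr e e'.
Qed.

Definition K0_mul (u v : K0 A) : K0 A := wcl (wmul (repr u) (repr v)).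

Lemma K0_mulE a b : K0_mul (wcl a) (wcl b) = wcl (wmul a b).
Proof.
rewrite /K0_mul (wmul_weqr _ (weq_repr b)) wmulC (wmul_weqr _ (weq_repr a)).
exact: wmulC.
Qed.

Lemma K0_ind (P : K0 A -> Prop) :
  (forall x, P (cl x)) -> P 0 -> (forall u, P u -> P (- u)) ->
  (forall u v, P u -> P v -> P (u + v)) -> forall u, P u.
Proof.
move=> Pg P0 PN PD u; rewrite -(wcl_repr u).
elim: (repr u) => [x||a Pa|a Pa b Pb].
- exact: Pg.
- exact: P0.
- by rewrite wclN; apply: PN.
- by rewrite wclD; apply: PD.
Qed.

Lemma K0_mulC : commutative K0_mul.
Proof. by move=> u v; apply: wmulC. Qed.

Lemma K0_mulDl : left_distributive K0_mul +%R.
Proof.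
move=> u v w; rewrite -(wcl_repr u) -(wcl_repr v) -(wcl_repr w).
by rewrite -wclD !K0_mulE /= wclD.
Qed.

Lemma K0_mulDr : right_distributive K0_mul +%R.
Proof. by move=> u v w; rewrite !(K0_mulC u) K0_mulDl. Qed.

Lemma K0_mulNl u v : K0_mul (- u) v = - K0_mul u v.
Proof.
rewrite -(wcl_repr u) -(wcl_repr v).
by rewrite -wclN !K0_mulE /= wclN.
Qed.

Lemma K0_mul0l v : K0_mul 0 v = 0.
Proof. by rewrite -(wcl_repr v) -wcl0 K0_mulE. Qed.

Lemma K0_mulNr u v : K0_mul u (- v) = - K0_mul u v.
Proof. by rewrite !(K0_mulC u) K0_mulNl. Qed.

Lemma K0_mul0r u : K0_mul u 0 = 0.
Proof. by rewrite K0_mulC K0_mul0l. Qed.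

Lemma K0_mul_cl x y : K0_mul (cl x) (cl y) = cl (x ⊗ y).
Proof. exact: K0_mulE. Qed.

Lemma K0_mulA : associative K0_mul.
Proof.
move=> u v w; elim/K0_ind: u => [x||u e|u u' e e'];
  rewrite ?(K0_mul0l, K0_mulNl, K0_mulDl) ?e ?e' //.
elim/K0_ind: v => [y||v e|v v' e e'];
  rewrite ?(K0_mul0l, K0_mul0r, K0_mulNl, K0_mulNr, K0_mulDl, K0_mulDr)
          ?e ?e' //.
elim/K0_ind: w => [z||w e|w w' e e'];
  rewrite ?(K0_mul0r, K0_mulNr, K0_mulDr) ?e ?e' //.
rewrite !K0_mul_cl; apply: cl_iso.
by exists (assoc x y z); apply: assoc_iso.
Qed.

Lemma K0_mul1 : left_id (cl unit) K0_mul.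
Proof.
elim/K0_ind => [x||u e|u u' e e'];
  rewrite ?(K0_mul0r, K0_mulNr, K0_mulDr) ?e ?e' //.
by rewrite K0_mul_cl; apply: cl_iso; exists (lunit x); apply: lunit_iso.
Qed.

HB.instance Definition _ :=
  GRing.Zmodule_isComPzRing.Build (K0 A) K0_mulA K0_mulC K0_mul1 K0_mulDl.

End GrothendieckRing.

Section LambdaRings.
Variable R : comPzRingType.

Record lambda_structure := LambdaStructure {
  lam :> nat -> R -> R;
  lam0 : forall x, lam 0%N x = 1;
  lam1 : forall x, lam 1%N x = x;
  lamD : forall n x y,
    lam n (x + y) = \sum_(i < n.+1) lam i x * lam (n - i)%N y }.

Definition finite_dimensional (L : lambda_structure) : Prop :=
  forall z : R, exists x y : R, z = x - y /\
    exists N, forall n, (N < n)%N -> L n x = 0 /\ L n y = 0.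

(* m (m - 1) ... (m - n + 1) / n!, also for negative m *)
Definition binz (m : int) (n : nat) : int :=
  ((\prod_(i < n) (m - i%:Z)) %/ (n`!)%:Z)%Z.

Record augmentation (L : lambda_structure) := Augmentation {
  aug :> {rmorphism R -> int};
  aug_lam : forall n x, aug (L n x) = binz (aug x) n }.

(* Power series over R are given by their coefficients. *)
Definition series_mul (s t : nat -> R) (n : nat) : R :=
  \sum_(i < n.+1) s i * t (n - i)%N.

Definition lambda_t (l : nat -> R -> R) (x : R) : nat -> R := fun n => l n x.

End LambdaRings.

Record fda_lambda_ring := FdaLambdaRing {
  flr_ring :> comPzRingType;
  flr_lam : lambda_structure flr_ring;
  flr_fin : finite_dimensional flr_lam;
  flr_aug : augmentation flr_lam }.

(* Morphisms are not required to commute with the augmentations: the degree 0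
   part of N-graded vector spaces is a morphism of ACTEPs that lowers ranks. *)
Record lambda_mor (R S : fda_lambda_ring) := LambdaMor {
  lm_fun :> {rmorphism R -> S};
  lm_lam : forall n x, lm_fun (flr_lam R n x) = flr_lam S n (lm_fun x) }.

Lemma lambda_mor_eq (R S : fda_lambda_ring) (f g : lambda_mor R S) :
  (forall x, f x = g x) -> f = g.
Proof.
case: f g => [[f cf] lf] [[g cg] lg] /= fg.
have {}fg : f = g by apply: functional_extensionality_dep.
subst g; have e : cf = cg.
  case: cf cg {lf lg} => [[a] [b]] [[a'] [b']].
  by rewrite (Prop_irrelevance a a') (Prop_irrelevance b b').
by subst cg; rewrite (Prop_irrelevance lf lg).
Qed.

Definition lambda_id (R : fda_lambda_ring) : lambda_mor R R :=
  @LambdaMor R R idfun (fun _ _ => erefl).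

Definition lambda_cmp (R S T : fda_lambda_ring)
  (g : lambda_mor S T) (f : lambda_mor R S) : lambda_mor R T.
Proof.
by refine (@LambdaMor R T (g \o f) _) => n x /=; rewrite !lm_lam.
Defined.

Definition FDALambdaRing : category.
Proof.
by refine (@Category fda_lambda_ring lambda_mor lambda_id lambda_cmp _ _ _)
  => *; apply: lambda_mor_eq.
Defined.

(* The operations on K0 C induced by the exterior products: the coefficients of
   the homomorphism lambda_t from K0 C to the multiplicative group 1 + K0 C [[t]]
   sending the class of an object x to the series of classes of ext l x. *)
Definition induced_by_ext (C : actep) (l : nat -> K0 C -> K0 C) : Prop :=
  [/\ forall x : C, lambda_t l (cl x) = fun n => cl (ext n x),
      forall a, lambda_t l a 0%N = 1
    & forall a b,
        lambda_t l (a + b) = series_mul (lambda_t l a) (lambda_t l b)].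

(* Main.v *)
(* An additive function on short exact sequences with values in an abelian group
   extends to K0.  For the group 1 + K0 C [[t]] and x |-> sum_n [ext n x] t^n,
   additivity is the telescoping of [F_0] along the filtration of ext n x; the
   lambda-structure is the resulting homomorphism.  Two homomorphisms out of K0
   agree when they agree on classes of objects, which gives the compatibility
   with the rank (lambda_t on Z being m |-> (1 + t)^m) and with morphisms.  The
   rank is multiplicative because of its values on ext 2 (x ⊕ y). *)
Require Import Defs.
From HB Require Import structures.
From mathcomp Require Import all_boot all_order all_algebra.
From mathcomp Require Import boolp.
From mathcomp Require Import zify.

Set Implicit Arguments.
Unset Strict Implicit.
Unset Printing Implicit Defensive.

Local Open Scope ring_scope.

(* Defs again, as vector.v shadows [hom]. *)
Import GRing.Theory Defs.
Local Open Scope actep_scope.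

(** * Additive maps out of the Grothendieck group *)

Lemma biproduct_short_exact (A : preadditive) (x y b : A)
    (i1 : hom x b) (i2 : hom y b) (p1 : hom b x) (p2 : hom b y) :
  is_biproduct i1 i2 p1 p2 -> short_exact i1 p2.
Proof.
move=> [p1i1 p2i2 p1i2 p2i1 ip].
have cmp0m (u v w : A) (h : hom u v) : (0 : hom v w) ∘ h = 0.
  by apply: (addrI (0 ∘ h)); rewrite -cmpDl !addr0.
have cmpm0 (u v w : A) (h : hom v w) : h ∘ (0 : hom u v) = 0.
  by apply: (addrI (h ∘ 0)); rewrite -cmpDr !addr0.
split; split=> // w g hg.
(* Since [p2 ∘ g = 0], composing [i1 ∘ p1 + i2 ∘ p2 = idm b] with [g] leaves [i1 ∘ (p1 ∘ g) = g];
   the cokernel case is dual. *)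
- exists (p1 ∘ g); split; last by move=> u <-; rewrite cmpA p1i1 cmp1m.
  by rewrite -[RHS]cmp1m -ip cmpDl -!cmpA hg cmpm0 addr0.
- exists (g ∘ i2); split; last by move=> u <-; rewrite -cmpA p2i2 cmpm1.
  by rewrite -[RHS]cmpm1 -ip cmpDr !cmpA hg cmp0m add0r.
Qed.

Section GrothendieckLift.
Variables (A : abelian) (M : zmodType).

Definition exact_additive (g : A -> M) : Prop :=
  forall (x' x x'' : A) (i : hom x' x) (p : hom x x''),
    short_exact i p -> g x = g x' + g x''.

Fixpoint word_eval (g : A -> M) (a : word A) : M :=
  match a with
  | Gen x => g x
  | Zero => 0
  | Opp a => - word_eval g a
  | Add a b => word_eval g a + word_eval g b
  end.

Lemma word_eval_weq g a b :
  exact_additive g -> weq a b -> word_eval g a = word_eval g b.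
Proof.
move=> gE; elim=> {a b} //=.
- by move=> a b c _ -> _ ->.
- by move=> a b _ ->.
- by move=> a a' b b' _ -> _ ->.
- by move=> a b c; rewrite addrA.
- by move=> a b; rewrite addrC.
- by move=> a; rewrite add0r.
- by move=> a; rewrite addNr.
Qed.

(** Carrying the additivity proof as an argument lets the instance declared below make every lift an
    additive map. *)
Definition K0_lift (g : A -> M) of exact_additive g : K0 A -> M :=
  fun u => word_eval g (repr u).

Variables (g : A -> M) (gE : exact_additive g).

Lemma K0_lift_wcl a : K0_lift gE (wcl a) = word_eval g a.
Proof. exact: word_eval_weq (weq_repr a). Qed.

Lemma K0_lift_cl x : K0_lift gE (cl x) = g x.
Proof. exact: K0_lift_wcl. Qed.

Lemma K0_lift_is_zmod_morphism : zmod_morphism (K0_lift gE).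
Proof.
move=> u v; rewrite -(wcl_repr u) -(wcl_repr v) -wclN -wclD.
by rewrite !K0_lift_wcl.
Qed.

HB.instance Definition _ :=
  GRing.isZmodMorphism.Build (K0 A) M (K0_lift gE) K0_lift_is_zmod_morphism.

End GrothendieckLift.

Lemma K0_additive_ext (A : abelian_tensor) (M : zmodType)
    (f g : {additive K0 A -> M}) :
  (forall x, f (cl x) = g (cl x)) -> forall u, f u = g u.
Proof.
move=> fg; elim/K0_ind => [x||u e|u v e e'] //.
- by rewrite !raddf0.
- by rewrite !raddfN e.
- by rewrite !raddfD e e'.
Qed.

Lemma clM (A : abelian_tensor) (x y : A) : cl x * cl y = cl (x ⊗ y).
Proof. exact: K0_mul_cl. Qed.

(** Both sides are biadditive, so induction on each factor reduces to classes of objects. This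
    serves both the rank and the maps induced by functors. *)
Lemma K0_additiveM (A : abelian_tensor) (R : comPzRingType)
    (f : {additive K0 A -> R}) :
  (forall x y, f (cl x * cl y) = f (cl x) * f (cl y)) ->
  {morph f : u v / u * v}.
Proof.
move=> fM u v; elim/K0_ind: u => [x||u e|u u' e e'];
  rewrite ?(mul0r, mulNr, mulrDl, raddf0, raddfN, raddfD) ?e ?e' //.
elim/K0_ind: v => [y||v e|v v' e e'];
  by rewrite ?(mulr0, mulrN, mulrDr, raddf0, raddfN, raddfD) ?e ?e'.
Qed.

(** Direct sums merge the positive parts and the negative parts separately; a zero object fills an
    empty part. *)
Lemma K0_difference (A : abelian_tensor) (u : K0 A) :
  exists x y : A, u = cl x - cl y.
Proof.
have clD (x y : A) : exists b : A, cl b = cl x + cl y.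
  have [b [i1 [i2 [p1 [p2 bp]]]]] := ab_biproduct x y.
  by exists b; apply: cl_exact (biproduct_short_exact bp).
have [z z0] := ab_zero A.
elim/K0_ind: u => [x||u [x [y ->]]|u v [x [y ->]] [x' [y' ->]]].
- by exists x, z; rewrite (cl_zero z0) subr0.
- by exists z, z; rewrite subrr.
- by exists y, x; rewrite opprB.
- have [b eb] := clD x x'; have [c ec] := clD y y'.
  by exists b, c; rewrite eb ec opprD addrACA.
Qed.

(** * The group of power series with constant term 1 *)

Section UnitSeries.
Variable R : comPzRingType.

Lemma series_mulC (s t : nat -> R) : series_mul s t = series_mul t s.
Proof.
apply: functional_extensionality_dep => n; rewrite /series_mul.
rewrite (reindex_inj rev_ord_inj) /=; apply: eq_bigr => i _.
by rewrite mulrC subSS subKn // -ltnS.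
Qed.

Lemma series_mulA (s t u : nat -> R) :
  series_mul s (series_mul t u) = series_mul (series_mul s t) u.
Proof.
(* Commutativity brings both sides to double sums of the same term [F i k] over [i + k <= n],
   differing only in the order of summation. *)
apply: functional_extensionality_dep => n; rewrite [series_mul t u]series_mulC.
rewrite [RHS](congr1 (@^~ n) (series_mulC _ u)) /series_mul.
pose F (i k : nat) := s i * (u k * t (n - i - k)%N).
transitivity (\sum_(i < n.+1) \sum_(k < n.+1 | (k <= n - i)%N) F i k).
  apply: eq_bigr => i _.
  by rewrite mulr_sumr (big_ord_narrow_leq (leq_subr _ _)).
rewrite (exchange_big_dep predT) //=; apply: eq_bigr => k _.
transitivity (\sum_(i < n.+1 | (i <= n - k)%N) F i k).
  by apply: eq_bigl => i; rewrite !leq_subRL ?leq_ord 1?addnC // -ltnS.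
rewrite (big_ord_narrow_leq (leq_subr _ _)) mulr_sumr.
by apply: eq_bigr => i _; rewrite /F /= mulrCA -!subnDA addnC.
Qed.

(** The group is written additively: its [+] is the product of series and its [0] the series 1. A
    homomorphism into it is then an additive map, and [K0_lift] applies. *)
Record useries := USeries {
  ucoef :> nat -> R;
  ucoef0 : ucoef 0%N = 1 }.

HB.instance Definition _ := gen_eqMixin useries.
HB.instance Definition _ := gen_choiceMixin useries.

Lemma useries_eq (s t : useries) : s =1 t -> s = t.
Proof.
case: s t => [s s0] [t t0] /= st.
have {}st : s = t by apply: functional_extensionality_dep.
by subst t; rewrite (Prop_irrelevance s0 t0).
Qed.

Lemma series_mul_coef0 (s t : useries) : series_mul s t 0%N = 1.
Proof. by rewrite /series_mul big_ord1 !ucoef0 mulr1. Qed.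

Definition useries_mul s t : useries := USeries (series_mul_coef0 s t).

Definition useries_one : useries :=
  @USeries (fun n => (n == 0%N)%:R) (mulr1n 1).

(* [r] lists the first n coefficients of the inverse of [s], where s 0 = 1. *)
Definition inv_next (s : nat -> R) (n : nat) (r : seq R) : R :=
  (n == 0%N)%:R - \sum_(i < n) s i.+1 * r`_(n - i.+1).

(** Each coefficient of the inverse depends on all earlier ones, so the recursion carries their
    list. *)
Fixpoint inv_coefs (s : nat -> R) (n : nat) : seq R :=
  if n is m.+1 then rcons (inv_coefs s m) (inv_next s m (inv_coefs s m))
  else [::].

Definition series_inv (s : nat -> R) (n : nat) : R :=
  inv_next s n (inv_coefs s n).

Lemma inv_coefsE s n : inv_coefs s n = mkseq (series_inv s) n.
Proof. by elim: n => //= n IHn; rewrite mkseqS -IHn. Qed.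

Lemma series_inv_coef0 s : series_inv s 0%N = 1.
Proof. by rewrite /series_inv /inv_next big_ord0 subr0. Qed.

Definition useries_inv (s : useries) : useries :=
  USeries (series_inv_coef0 s).

Lemma useries_mulA : associative useries_mul.
Proof. by move=> s t u; apply: useries_eq => n /=; rewrite series_mulA. Qed.

Lemma useries_mulC : commutative useries_mul.
Proof. by move=> s t; apply: useries_eq => n /=; rewrite series_mulC. Qed.

Lemma useries_mul1 : left_id useries_one useries_mul.
Proof.
move=> s; apply: useries_eq => n /=; rewrite /series_mul big_ord_recl /=.
by rewrite mul1r subn0 big1 ?addr0 // => i _; rewrite mul0r.
Qed.

Lemma useries_mulV : left_inverse useries_one useries_inv useries_mul.
Proof.
move=> s; rewrite useries_mulC; apply: useries_eq => n /=.
(* The term of index 0 is the n-th coefficient of the inverse, defined so as to cancel the remaining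
   terms up to the coefficient of 1. *)
rewrite /series_mul big_ord_recl ucoef0 mul1r subn0 /= {1}/series_inv.
rewrite /inv_next addrAC -addrA -[RHS]addr0; congr (_ + _).
apply/eqP; rewrite subr_eq0; apply/eqP/eq_bigr => i _.
(* The index [n - i.+1] is below [n], so the default value of [nth] never occurs. *)
by rewrite inv_coefsE nth_mkseq // ltn_subrL /= (leq_ltn_trans _ (ltn_ord i)).
Qed.

HB.instance Definition _ := GRing.isZmodule.Build useries
  useries_mulA useries_mulC useries_mul1 useries_mulV.

Lemma useriesD (s t : useries) : ucoef (s + t) = series_mul s t.
Proof. by []. Qed.

End UnitSeries.

(** * Ring morphisms applied to coefficients *)

Section MapSeries.
Variables (R S : comPzRingType) (f : {rmorphism R -> S}).

Lemma map_series_coef0 (s : useries R) : f (s 0%N) = 1.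
Proof. by rewrite ucoef0 rmorph1. Qed.

Definition map_useries (s : useries R) : useries S :=
  @USeries S (fun n => f (s n)) (map_series_coef0 s).

Lemma map_useriesD : {morph map_useries : s t / s + t}.
Proof.
move=> s t; apply: useries_eq => n; rewrite useriesD /= /series_mul.
by rewrite rmorph_sum; apply: eq_bigr => i _; rewrite rmorphM.
Qed.

Lemma map_useries_is_zmod_morphism : zmod_morphism map_useries.
Proof.
move=> s t; apply: (addIr (map_useries t)).
by rewrite -map_useriesD !subrK.
Qed.

HB.instance Definition _ := GRing.isZmodMorphism.Build (useries R) (useries S)
  map_useries map_useries_is_zmod_morphism.

End MapSeries.

(** * Binomial coefficients of integers and the series of (1 + t)^m *)

Section IntegerBinomials.

Definition falling (m : int) (n : nat) : int := \prod_(i < n) (m - i%:Z).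

Lemma fallingS m n : falling (m + 1) n.+1 = (m + 1) * falling m n.
Proof.
rewrite /falling big_ord_recl subr0; congr (_ * _); apply: eq_bigr => i _.
by rewrite lift0 -add1n PoszD opprD addrA addrK.
Qed.

(** Both falling factorials are multiples of [falling m n], with cofactors m + 1 and m - n, which
    differ by n + 1. *)
Lemma falling_pascal m n :
  falling (m + 1) n.+1 = falling m n.+1 + n.+1%:Z * falling m n.
Proof.
rewrite fallingS [falling m n.+1]big_ord_recr /= -/(falling m n).
rewrite (mulrC (falling m n)) -mulrDl; congr (_ * _).
by rewrite -addn1 PoszD addrA subrK.
Qed.

(** Pascal's rule can be read in both directions, so this principle also reaches the negative
    integers. *)
Lemma int_shift_ind (P : int -> Prop) :
  P 0 -> (forall m, P m -> P (m + 1)) -> (forall m, P (m + 1) -> P m) ->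
  forall m, P m.
Proof.
move=> P0 PS PP; elim=> [|n Pn|n Pn] //.
  by rewrite -addn1 PoszD; apply: PS.
by apply: PP; rewrite -addn1 PoszD opprD subrK.
Qed.

Lemma falling0 n : falling 0 n.+1 = 0.
Proof. by rewrite /falling big_ord_recl subrr mul0r. Qed.

(** This makes the division in [binz] exact. By [falling_pascal], the values at m and m + 1 differ
    by [n.+1%:Z * falling m n], which (n+1)! divides by induction on n; the value at 0 vanishes. *)
Lemma fact_dvd_falling m n : ((n`!)%:Z %| falling m n)%Z.
Proof.
elim: n m => [|n IHn] m; first by rewrite dvd1z.
have dvdn m' : (((n.+1)`!)%:Z %| n.+1%:Z * falling m' n)%Z.
  by rewrite factS PoszM dvdz_mul.
elim/int_shift_ind: m => [|m|m]; first by rewrite falling0 dvdz0.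
  by move=> dvdm; rewrite falling_pascal rpredD.
by rewrite falling_pascal rpredDr.
Qed.

Lemma binzK m n : binz m n * (n`!)%:Z = falling m n.
Proof. exact: divzK (fact_dvd_falling m n). Qed.

Lemma fact_int_neq0 n : (n`!)%:Z != 0.
Proof. by rewrite -lt0n fact_gt0. Qed.

Lemma binz0 m : binz m 0 = 1.
Proof. by rewrite /binz big_ord0. Qed.

Lemma binz0S n : binz 0 n.+1 = 0.
Proof. by rewrite /binz -/(falling 0 n.+1) falling0 div0z. Qed.

Lemma binz_pascal m n : binz (m + 1) n.+1 = binz m n.+1 + binz m n.
Proof.
apply: (mulIf (fact_int_neq0 n.+1)); rewrite mulrDl !binzK falling_pascal.
by congr (_ + _); rewrite -binzK factS PoszM mulrCA.
Qed.

Lemma binz_nat (m n : nat) : binz m n = 'C(m, n).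
Proof.
elim: m n => [|m IHm] [|n]; rewrite ?binz0 ?bin0 // ?binz0S //.
by rewrite -addn1 PoszD binz_pascal !IHm addn1 binS PoszD.
Qed.

(* (1 + t)^m, for an integer m *)
Definition binz_series (m : int) : useries int := USeries (binz0 m).

Lemma binz_series0 : binz_series 0 = 0.
Proof. by apply: useries_eq => -[|n] /=; rewrite ?binz0 ?binz0S. Qed.

Lemma binz_seriesS m : binz_series (m + 1) = binz_series m + binz_series 1.
Proof.
rewrite [RHS]addrC; apply: useries_eq => n; rewrite useriesD /series_mul.
case: n => [|n]; first by rewrite big_ord1 /= !binz0.
(* Only the coefficients of index 0 and 1 of 1 + t survive, leaving the two terms of Pascal's
   rule. *)
rewrite big_ord_recl big_ord_recl big1 ?addr0 /=.
  by rewrite binz_pascal binz0 (binz_nat 1 1) !mul1r subSS !subn0.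
by move=> i _; rewrite (binz_nat 1) bin_small ?mul0r.
Qed.

Lemma binz_series_is_zmod_morphism : zmod_morphism binz_series.
Proof.
(* In additive notation, the power (1 + t)^m is the m-th multiple of 1 + t. *)
have binz_seriesZ m : binz_series m = binz_series 1 *~ m.
  elim/int_shift_ind: m => [|m e|m]; first by rewrite binz_series0 mulr0z.
    by rewrite binz_seriesS e mulrzDr.
  by rewrite binz_seriesS mulrzDr => /addIr.
by move=> m n; rewrite (binz_seriesZ (m - n)) mulrzBr -!binz_seriesZ.
Qed.

HB.instance Definition _ := GRing.isZmodMorphism.Build int (useries int)
  binz_series binz_series_is_zmod_morphism.

End IntegerBinomials.

(** * The lambda-structure and the augmentation on the Grothendieck ring *)

Section LambdaOperations.
Variable C : actep.

Lemma cl_ext0 (x : C) : cl (ext 0 x) = 1.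
Proof. exact: cl_iso (ext0 x). Qed.

Lemma cl_ext1 (x : C) : cl (ext 1 x) = cl x.
Proof. exact: cl_iso (ext1 x). Qed.

Definition ext_series (x : C) : useries (K0 C) :=
  @USeries (K0 C) (fun n => cl (ext n x)) (cl_ext0 x).

Lemma ext_series_exact : exact_additive ext_series.
Proof.
(* The filtration exists only from degree 2 on; degrees 0 and 1 follow from [ext0], [ext1] and
   exactness. *)
move=> x' x x'' i p se; apply: useries_eq => -[|[|n]]; rewrite useriesD.
- by rewrite /series_mul big_ord1 /= !cl_ext0 mulr1.
- rewrite /series_mul big_ord_recl big_ord1 /= !cl_ext0 !cl_ext1 mul1r mulr1.
  by rewrite addrC; apply: cl_exact se.
have [F [inc [F0 Fz Fk]]] := ext_filtration se (isT : (1 < n.+2)%N).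
have telescope k : (k <= n.+3)%N -> cl (F 0%N) =
    \sum_(j < k) cl (ext j x') * cl (ext (n.+2 - j) x'') + cl (F k).
  elim: k => [|k IHk] lek; first by rewrite big_ord0 add0r.
  have [q seq] := Fk k lek.
  rewrite (IHk (ltnW lek)) (cl_exact seq) big_ord_recr /= -clM.
  by rewrite -addrA [cl _ + _]addrC.
(* In degree n + 2 the filtration reaches zero at step n + 3. *)
by rewrite /= -F0 (telescope n.+3) // (cl_zero Fz) addr0.
Qed.

Definition K0_lambda_t : K0 C -> useries (K0 C) := K0_lift ext_series_exact.

HB.instance Definition _ := GRing.Additive.on K0_lambda_t.

Lemma K0_lambda_t_cl x : K0_lambda_t (cl x) = ext_series x.
Proof. exact: K0_lift_cl. Qed.

Lemma K0_lambda1 u : K0_lambda_t u 1%N = u.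
Proof.
(* Constant terms are 1, so multiplying series adds their coefficients of t. *)
have coef1D (s t : useries (K0 C)) : (s + t) 1%N = s 1%N + t 1%N.
  rewrite useriesD /series_mul big_ord_recl big_ord1 /= !ucoef0.
  by rewrite mul1r mulr1 addrC.
elim/K0_ind: u => [x||u e|u v e e'].
- by rewrite K0_lambda_t_cl /= cl_ext1.
- by rewrite raddf0.
- by apply: (addrI u); rewrite subrr -{1}e -coef1D -raddfD subrr raddf0.
- by rewrite raddfD coef1D e e'.
Qed.

Definition K0_lambda : lambda_structure (K0 C).
Proof.
refine (@LambdaStructure _ (fun n u => K0_lambda_t u n) _ _ _).
- by move=> u; apply: ucoef0.
- exact: K0_lambda1.
- by move=> n u v; rewrite raddfD.
Defined.

Lemma K0_lambda_finite : finite_dimensional K0_lambda.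
Proof.
move=> u; have [x [y ->]] := K0_difference u; exists (cl x), (cl y); split=> //.
exists (rk x + rk y)%N => n ltn; rewrite /= !K0_lambda_t_cl /=.
by split; apply/cl_zero/ext_gt_rk; apply: leq_ltn_trans ltn;
  rewrite ?leq_addr ?leq_addl.
Qed.

Lemma K0_lambda_induced : induced_by_ext K0_lambda.
Proof.
split.
- by move=> x; rewrite /lambda_t /= K0_lambda_t_cl.
- by move=> a; apply: lam0.
- by move=> a b; rewrite /lambda_t /= raddfD.
Qed.

Lemma rk_exact_additive : exact_additive (fun x : C => (rk x)%:Z).
Proof. by move=> x' x x'' i p se; rewrite (rk_exact se). Qed.

Definition K0_rank : K0 C -> int := K0_lift rk_exact_additive.

HB.instance Definition _ := GRing.Additive.on K0_rank.

Lemma K0_rank_cl x : K0_rank (cl x) = rk x.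
Proof. exact: K0_lift_cl. Qed.

(* Compare the ranks in ext 2 (x ⊕ y), using that C(a + b, 2) is
   C(a, 2) + a b + C(b, 2). *)
Lemma rk_tens (x y : C) : rk (x ⊗ y) = (rk x * rk y)%N.
Proof.
have bin2D (a b : nat) : 'C(a + b, 2) = ('C(b, 2) + (a * b + 'C(a, 2)))%N.
  elim: a => [|a IHa]; first by rewrite addn0.
  by rewrite addSn !binS IHa !bin1 mulSn; lia.
have [b [i1 [i2 [p1 [p2 /biproduct_short_exact se]]]]] := ab_biproduct x y.
have /(congr1 (fun s : useries _ => K0_rank (s 2%N))) := ext_series_exact se.
(* The degree 2 coefficient is [ext 2 y] + [x][y] + [ext 2 x]; the outer ranks cancel against the
   outer terms of [bin2D]. *)
rewrite useriesD /series_mul 2!big_ord_recl big_ord1 /= !cl_ext0 !cl_ext1.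
rewrite mul1r mulr1 !raddfD clM /= !K0_rank_cl !rk_ext (rk_exact se) bin2D.
by rewrite -!PoszD => -[] /addnI /addIn.
Qed.

Lemma K0_rank_is_monoid_morphism : monoid_morphism K0_rank.
Proof.
split=> [|u v]; first by rewrite [LHS]K0_rank_cl rk_unit.
by apply: K0_additiveM => x y; rewrite clM /= !K0_rank_cl rk_tens PoszM.
Qed.

HB.instance Definition _ := GRing.isMonoidMorphism.Build (K0 C) int
  K0_rank K0_rank_is_monoid_morphism.

Lemma K0_rank_lambda n u : K0_rank (K0_lambda n u) = binz (K0_rank u) n.
Proof.
(* A single operation is not additive in [u] in general, but the whole series is, so it suffices to
   compare on objects, where [rk_ext] decides. *)
suffices e : map_useries K0_rank (K0_lambda_t u) = binz_series (K0_rank u).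
  exact: (congr1 (fun s : useries int => s n) e).
apply: (K0_additive_ext (f := map_useries K0_rank \o K0_lambda_t)
                        (g := binz_series \o K0_rank)) => x /=.
apply: useries_eq => k; rewrite K0_lambda_t_cl /= !K0_rank_cl rk_ext.
by rewrite binz_nat.
Qed.

Definition K0_augmentation : augmentation K0_lambda :=
  @Augmentation _ K0_lambda K0_rank K0_rank_lambda.

End LambdaOperations.

(** * The lambda-ring morphism induced by a morphism of ACTEPs *)

Section InducedMorphism.
Variables (D C : actep) (f : actep_mor D C).

Lemma cl_fo_exact : exact_additive (fun x : D => cl (f x)).
Proof. by move=> x' x x'' i p se; apply: cl_exact (fm_exact f se). Qed.

Definition K0_map : K0 D -> K0 C := K0_lift cl_fo_exact.

HB.instance Definition _ := GRing.Additive.on K0_map.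

Lemma K0_map_cl x : K0_map (cl x) = cl (f x).
Proof. exact: K0_lift_cl. Qed.

Lemma K0_map_is_monoid_morphism : monoid_morphism K0_map.
Proof.
split=> [|u v].
  rewrite [LHS]K0_map_cl; apply/esym/cl_iso.
  by exists (fu f); apply: fu_iso.
apply: K0_additiveM => x y; rewrite clM /= !K0_map_cl clM.
apply/esym/cl_iso.
by exists (ft f x y); apply: ft_iso.
Qed.

HB.instance Definition _ := GRing.isMonoidMorphism.Build (K0 D) (K0 C)
  K0_map K0_map_is_monoid_morphism.

Lemma K0_map_lambda n u : K0_map (K0_lambda D n u) = K0_lambda C n (K0_map u).
Proof.
(* Again all degrees are treated at once to obtain additive maps; on objects the isomorphisms [fe]
   conclude. *)
suffices e : map_useries K0_map (K0_lambda_t u) = K0_lambda_t (K0_map u).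
  exact: (congr1 (fun s : useries (K0 C) => s n) e).
apply: (K0_additive_ext (f := map_useries K0_map \o @K0_lambda_t D)
                        (g := @K0_lambda_t C \o K0_map)) => x /=.
apply: useries_eq => k; rewrite K0_map_cl !K0_lambda_t_cl /= K0_map_cl.
by apply: cl_iso; exists (fe f k x); apply: fe_iso.
Qed.

End InducedMorphism.

(** * Functoriality *)

Definition K0_ring (C : actep) : fda_lambda_ring :=
  FdaLambdaRing (@K0_lambda_finite C) (K0_augmentation C).

Definition K0_mor (D C : actep) (f : actep_mor D C) :
    lambda_mor (K0_ring D) (K0_ring C) :=
  @LambdaMor (K0_ring D) (K0_ring C) (K0_map f) (K0_map_lambda f).

Lemma K0_mor_id (C : actep) : K0_mor (actep_id C) = lambda_id (K0_ring C).
Proof.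
apply: lambda_mor_eq.
apply: (K0_additive_ext (f := K0_map (actep_id C)) (g := idfun)) => x.
exact: K0_map_cl.
Qed.

Lemma K0_mor_cmp (E D C : actep) (g : actep_mor D C) (f : actep_mor E D) :
  K0_mor (actep_cmp g f) = lambda_cmp (K0_mor g) (K0_mor f).
Proof.
apply: lambda_mor_eq.
apply: (K0_additive_ext (f := K0_map (actep_cmp g f))
                        (g := K0_map g \o K0_map f)) => x /=.
by rewrite !K0_map_cl.
Qed.

Definition K0_functor : @functor_on ACTEP FDALambdaRing K0_ring :=
  @FunctorOn ACTEP FDALambdaRing K0_ring K0_mor K0_mor_id
    (fun E D C g f => K0_mor_cmp g f).

Theorem theorem1p1 :
  exists (L : forall C : actep, lambda_structure (K0 C))
         (fin : forall C : actep, finite_dimensional (L C))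
         (eps : forall C : actep, augmentation (L C)),
    (forall C : actep, induced_by_ext (L C)) /\
    (forall (C : actep) (x : C), eps C (cl x) = (rk x)%:Z) /\
    exists F : @functor_on ACTEP FDALambdaRing
                 (fun C : actep => FdaLambdaRing (fin C) (eps C)),
      forall (D C : actep) (f : actep_mor D C) (x : D),
        (fmap F f : lambda_mor _ _) (cl x) = cl (f x).
Proof.
exists K0_lambda, K0_lambda_finite, K0_augmentation; split; last split.
- exact: K0_lambda_induced.
- exact: K0_rank_cl.
- by exists K0_functor => D C f x; apply: K0_map_cl.
Qed.
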